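(* Let $$A=\begin{pmatrix} a_{11} & a_{12} & a_{13}\\ a_{12} & a_{22} & a_{23}\\ a_{13} & a_{23} & a_{33}\end{pmatrix}$$ be the generic (symbolic) symmetric $3\times 3$ matrix with positive entries. Its Sinkhorn limit $S=(s_{ij})$ is a symmetric $3\times 3$ doubly-stochastic matrix whose $(1,1)$ entry is given by $$s_{11}=a_{11}\,z,$$ where $z$ is the positive root of the quartic equation $c_4z^4+c_3z^3+c_2z^2+c_1z+c_0=0$, with coefficients $$\begin{aligned} c_4={}& a_{11}^4a_{22}^2a_{33}^2-a_{11}^4a_{22}a_{23}^2a_{33}-2a_{11}^3a_{12}^2a_{22}a_{33}^2+a_{11}^3a_{12}^2a_{23}^2a_{33}+2a_{11}^3a_{12}a_{13}a_{22}a_{23}a_{33}\\ &-2a_{11}^3a_{13}^2a_{22}^2a_{33}+a_{11}^3a_{13}^2a_{22}a_{23}^2+a_{11}^2a_{12}^4a_{33}^2-2a_{11}^2a_{12}^3a_{13}a_{23}a_{33}+3a_{11}^2a_{12}^2a_{13}^2a_{22}a_{33}\\ &-a_{11}^2a_{12}^2a_{13}^2a_{23}^2-2a_{11}^2a_{12}a_{13}^3a_{22}a_{23}+a_{11}^2a_{13}^4a_{22}^2-a_{11}a_{12}^4a_{13}^2a_{33}+2a_{11}a_{12}^3a_{13}^3a_{23}-a_{11}a_{12}^2a_{13}^4a_{22},\\[4pt] c_3={}& -4a_{11}^3a_{22}^2a_{33}^2+4a_{11}^3a_{22}a_{23}^2a_{33}+4a_{11}^2a_{12}^2a_{22}a_{33}^2-3a_{11}^2a_{12}^2a_{23}^2a_{33}-2a_{11}^2a_{12}a_{13}a_{22}a_{23}a_{33}\\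 &+4a_{11}^2a_{13}^2a_{22}^2a_{33}-3a_{11}^2a_{13}^2a_{22}a_{23}^2-2a_{11}a_{12}^2a_{13}^2a_{22}a_{33}+2a_{11}a_{12}^2a_{13}^2a_{23}^2-a_{12}^4a_{13}^2a_{33}\\ &+2a_{12}^3a_{13}^3a_{23}-a_{12}^2a_{13}^4a_{22},\\[4pt] c_2={}& 6a_{11}^2a_{22}^2a_{33}^2-6a_{11}^2a_{22}a_{23}^2a_{33}-2a_{11}a_{12}^2a_{22}a_{33}^2+3a_{11}a_{12}^2a_{23}^2a_{33}-2a_{11}a_{12}a_{13}a_{22}a_{23}a_{33}\\ &-2a_{11}a_{13}^2a_{22}^2a_{33}+3a_{11}a_{13}^2a_{22}a_{23}^2+2a_{12}^3a_{13}a_{23}a_{33}-3a_{12}^2a_{13}^2a_{22}a_{33}-a_{12}^2a_{13}^2a_{23}^2+2a_{12}a_{13}^3a_{22}a_{23},\\[4pt] c_1={}& -4a_{11}a_{22}^2a_{33}^2+4a_{11}a_{22}a_{23}^2a_{33}-a_{12}^2a_{23}^2a_{33}+2a_{12}a_{13}a_{22}a_{23}a_{33}-a_{13}^2a_{22}a_{23}^2,\\[4pt] c_0={}& a_{22}^2a_{33}^2-a_{22}a_{23}^2a_{33}. \end{aligned}$$ Furthermore, the diagonal matrix $X$ with positive diagonal entries such that $S=XAX$ has its $(1,1)$ entry given by $x_{11}=\sqrt{z}$.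
   Context: A square matrix is row-stochastic if each of its rows sums to $1$, column-stochastic if each of its columns sums to $1$, and doubly-stochastic if it is both. For a square matrix $A$ with positive entries, let $R(A)$ be the matrix obtained by dividing each row of $A$ by its sum, and $C(A)$ the matrix obtained by dividing each column of $A$ by its sum. The Sinkhorn algorithm alternately applies $R$ and $C$, starting from $A$; the Sinkhorn limit $S$ of $A$ is the limit of the resulting sequence of matrices. This limit is doubly-stochastic, and when $A$ is symmetric, $S$ is symmetric and there is a unique diagonal matrix $X$ with positive diagonal entries such that $S=XAX$.
   Formalization: The quartic can have several positive roots (e.g. four for a11=3, a12=a13=a23=1, a22=4, a33=5), so ''the positive root'' is replaced by: there is a positive root z with s11 = a11 z and x11 = sqrt(z). *)

(* Defs.v *)
From mathcomp Require Import all_boot all_order all_algebra.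
From mathcomp Require Import all_classical all_reals all_analysis.

Set Implicit Arguments.
Unset Strict Implicit.
Unset Printing Implicit Defensive.

Import Order.TTheory GRing.Theory Num.Theory.
Import numFieldNormedType.Exports.

Local Open Scope classical_set_scope.
Local Open Scope ring_scope.

Definition row_stochastic (R : realType) (n : nat) (M : 'M[R]_n) : Prop :=
  forall i, \sum_j M i j = 1.

Definition col_stochastic (R : realType) (n : nat) (M : 'M[R]_n) : Prop :=
  forall j, \sum_i M i j = 1.

Definition doubly_stochastic (R : realType) (n : nat) (M : 'M[R]_n) : Prop :=
  row_stochastic M /\ col_stochastic M.

Definition row_scale (R : realType) (n : nat) (M : 'M[R]_n) : 'M[R]_n :=
  \matrix_(i, j) (M i j / \sum_k M i k).

Definition col_scale (R : realType) (n : nat) (M : 'M[R]_n) : 'M[R]_n :=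
  \matrix_(i, j) (M i j / \sum_k M k j).

(* A, R(A), C(R(A)), R(C(R(A))), ... : every half-step is a term of the
   sequence. *)
Fixpoint sinkhorn_seq (R : realType) (n : nat) (A : 'M[R]_n) (k : nat)
    : 'M[R]_n :=
  if k is k'.+1 then
    if odd k' then col_scale (sinkhorn_seq A k')
    else row_scale (sinkhorn_seq A k')
  else A.

(* As with any [lim], the value is meaningful only when [sinkhorn_seq A]
   converges. The size is a successor so that matrices carry the entrywise
   topology of a normed module. *)
Definition sinkhorn_limit (R : realType) (n : nat) (A : 'M[R]_n.+1)
    : 'M[R]_n.+1 :=
  lim (sinkhorn_seq A @ \oo).

Definition pos_diag_mx (R : realType) (n : nat) (X : 'M[R]_n) : Prop :=
  is_diag_mx X /\ (forall i, 0 < X i i).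

Definition sym3 (R : realType) (a11 a12 a13 a22 a23 a33 : R) : 'M[R]_3 :=
  \matrix_(i < 3, j < 3)
    nth 0 (nth [::] [:: [:: a11; a12; a13];
                        [:: a12; a22; a23];
                        [:: a13; a23; a33]] i) j.

Definition quartic_c4 (R : realType) (a11 a12 a13 a22 a23 a33 : R) : R :=
    a11 ^+ 4 * a22 ^+ 2 * a33 ^+ 2
    - a11 ^+ 4 * a22 * a23 ^+ 2 * a33
    - 2 * a11 ^+ 3 * a12 ^+ 2 * a22 * a33 ^+ 2
    + a11 ^+ 3 * a12 ^+ 2 * a23 ^+ 2 * a33
    + 2 * a11 ^+ 3 * a12 * a13 * a22 * a23 * a33
    - 2 * a11 ^+ 3 * a13 ^+ 2 * a22 ^+ 2 * a33
    + a11 ^+ 3 * a13 ^+ 2 * a22 * a23 ^+ 2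
    + a11 ^+ 2 * a12 ^+ 4 * a33 ^+ 2
    - 2 * a11 ^+ 2 * a12 ^+ 3 * a13 * a23 * a33
    + 3 * a11 ^+ 2 * a12 ^+ 2 * a13 ^+ 2 * a22 * a33
    - a11 ^+ 2 * a12 ^+ 2 * a13 ^+ 2 * a23 ^+ 2
    - 2 * a11 ^+ 2 * a12 * a13 ^+ 3 * a22 * a23
    + a11 ^+ 2 * a13 ^+ 4 * a22 ^+ 2
    - a11 * a12 ^+ 4 * a13 ^+ 2 * a33
    + 2 * a11 * a12 ^+ 3 * a13 ^+ 3 * a23
    - a11 * a12 ^+ 2 * a13 ^+ 4 * a22.

Definition quartic_c3 (R : realType) (a11 a12 a13 a22 a23 a33 : R) : R :=
    - 4 * a11 ^+ 3 * a22 ^+ 2 * a33 ^+ 2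
    + 4 * a11 ^+ 3 * a22 * a23 ^+ 2 * a33
    + 4 * a11 ^+ 2 * a12 ^+ 2 * a22 * a33 ^+ 2
    - 3 * a11 ^+ 2 * a12 ^+ 2 * a23 ^+ 2 * a33
    - 2 * a11 ^+ 2 * a12 * a13 * a22 * a23 * a33
    + 4 * a11 ^+ 2 * a13 ^+ 2 * a22 ^+ 2 * a33
    - 3 * a11 ^+ 2 * a13 ^+ 2 * a22 * a23 ^+ 2
    - 2 * a11 * a12 ^+ 2 * a13 ^+ 2 * a22 * a33
    + 2 * a11 * a12 ^+ 2 * a13 ^+ 2 * a23 ^+ 2
    - a12 ^+ 4 * a13 ^+ 2 * a33
    + 2 * a12 ^+ 3 * a13 ^+ 3 * a23
    - a12 ^+ 2 * a13 ^+ 4 * a22.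

Definition quartic_c2 (R : realType) (a11 a12 a13 a22 a23 a33 : R) : R :=
    6 * a11 ^+ 2 * a22 ^+ 2 * a33 ^+ 2
    - 6 * a11 ^+ 2 * a22 * a23 ^+ 2 * a33
    - 2 * a11 * a12 ^+ 2 * a22 * a33 ^+ 2
    + 3 * a11 * a12 ^+ 2 * a23 ^+ 2 * a33
    - 2 * a11 * a12 * a13 * a22 * a23 * a33
    - 2 * a11 * a13 ^+ 2 * a22 ^+ 2 * a33
    + 3 * a11 * a13 ^+ 2 * a22 * a23 ^+ 2
    + 2 * a12 ^+ 3 * a13 * a23 * a33
    - 3 * a12 ^+ 2 * a13 ^+ 2 * a22 * a33
    - a12 ^+ 2 * a13 ^+ 2 * a23 ^+ 2
    + 2 * a12 * a13 ^+ 3 * a22 * a23.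

Definition quartic_c1 (R : realType) (a11 a12 a13 a22 a23 a33 : R) : R :=
    - 4 * a11 * a22 ^+ 2 * a33 ^+ 2
    + 4 * a11 * a22 * a23 ^+ 2 * a33
    - a12 ^+ 2 * a23 ^+ 2 * a33
    + 2 * a12 * a13 * a22 * a23 * a33
    - a13 ^+ 2 * a22 * a23 ^+ 2.

Definition quartic_c0 (R : realType) (a11 a12 a13 a22 a23 a33 : R) : R :=
    a22 ^+ 2 * a33 ^+ 2
    - a22 * a23 ^+ 2 * a33.

(* Main.v *)
Require Import Defs.
From mathcomp Require Import all_boot all_order all_algebra.
From mathcomp Require Import all_classical all_reals all_analysis.
From mathcomp Require Import ring lra.

Import Order.TTheory GRing.Theory Num.Theory.
Import numFieldNormedType.Exports.

Local Open Scope classical_set_scope.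
Local Open Scope ring_scope.

(** The proof has two independent halves.

    Convergence holds for every positive square matrix [A].  After one
    normalization each term of the sequence is, up to transposition, a
    row-stochastic matrix [M], and the next term divides its columns by their
    sums.  The new row sums are then averages, weighted by the rows of [M], of
    the inverses of the old column sums; if every entry of [M] is at least [d],
    averaging shrinks the relative spread of the sums by the factor [1 - d]
    ([col_spread_contract]).  The constant [d] can be chosen once for the whole
    sequence because scaling rows and columns does not change the cross-ratios
    [M i j * M k l / (M i l * M k j)], and these together with the column sums
    bound the entries from below ([entry_ge_col_sum]).  Hence all row and column
    sums tend to 1 geometrically, the sequence moves by geometrically small
    steps, and it converges to a positive doubly stochastic [S] with the same
    cross-ratios as [A] ([sinkhorn_cvg]).

    Equal cross-ratios mean that [S i j = d i * A i j * e j] for positive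
    vectors [d] and [e].  When [A] is symmetric, [S^T] is another doubly
    stochastic scaling of [A]; a positive doubly stochastic matrix has only
    trivial doubly stochastic scalings ([doubly_stochastic_scaling_trivial]), so
    [S^T = S] and [e] is proportional to [d], and balancing the two gives
    [S = X A X] ([symmetric_scaling]).  Comparing diagonal entries shows that
    [X] is unique.

    For the quartic, let [x], [y], [w] be the diagonal of [X] and [z = x ^+ 2].
    The first row-sum equation is linear in [p = x * y] and [x * w]; using it to
    eliminate [x * w] from the other two, multiplied by [z], leaves two
    quadratics in [p] with coefficients polynomial in [z].  They have a common
    root, so their resultant vanishes, and this resultant is [a13 ^+ 2] times
    the quartic ([quartic_root]). *)

(** * Row scaling, column sums and cross-ratios *)

Definition pos_mx {R : realType} {n : nat} (M : 'M[R]_n) : Prop :=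
  forall i j, 0 < M i j.

Definition col_sum {R : realType} {n : nat} (M : 'M[R]_n) (j : 'I_n) : R :=
  \sum_i M i j.

(** The relative spread of the column sums; unlike a bound on their differences
    it behaves well under taking inverses, which every step of the iteration
    does. *)
Definition col_spread_le {R : realType} {n : nat} (e : R) (M : 'M[R]_n)
    : Prop :=
  forall i j, col_sum M i <= (1 + e) * col_sum M j.

Definition cross_ratio {R : realType} {n : nat} (M : 'M[R]_n) i j k l : R :=
  M i j * M k l / (M i l * M k j).

Section Scaling.
Context {R : realType} {n : nat}.
Implicit Type M : 'M[R]_n.+1.

Lemma col_scaleE M : col_scale M = (row_scale M^T)^T.
Proof.
apply/matrixP => i j; rewrite !mxE; congr (_ / _).
by apply: eq_bigr => k _; rewrite mxE.
Qed.

Lemma pos_mx_tr M : pos_mx M -> pos_mx M^T.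
Proof. by move=> Mp i j; rewrite mxE. Qed.

Lemma sum_ord_gt0 (f : 'I_n.+1 -> R) : (forall i, 0 < f i) -> 0 < \sum_i f i.
Proof.
move=> fp; rewrite big_ord_recl ltr_wpDr ?fp // sumr_ge0 // => i _.
exact/ltW/fp.
Qed.

Lemma pos_row_scale M : pos_mx M -> pos_mx (row_scale M).
Proof. by move=> Mp i j; rewrite mxE divr_gt0 ?sum_ord_gt0. Qed.

Lemma row_scale_stochastic M : pos_mx M -> row_stochastic (row_scale M).
Proof.
move=> Mp i; under eq_bigr => j _ do rewrite mxE.
by rewrite -mulr_suml divff // gt_eqF // sum_ord_gt0.
Qed.

Lemma cross_ratio_tr M i j k l :
  cross_ratio M^T i j k l = cross_ratio M j i l k.
Proof. by rewrite /cross_ratio !mxE [M l i * _]mulrC. Qed.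

Lemma cross_ratio_row_scale M i j k l : pos_mx M ->
  cross_ratio (row_scale M) i j k l = cross_ratio M i j k l.
Proof.
move=> Mp; rewrite /cross_ratio !mxE.
have h i' : \sum_k M i' k != 0 by rewrite gt_eqF // sum_ord_gt0.
by field; rewrite !h !gt_eqF.
Qed.

(** Summing [M k j * M i l <= K * (M i j * M k l)] over [l] compares any two
    entries of a column, since the rows sum to 1; summing over [k] then compares
    an entry with its column sum. *)
Lemma entry_ge_col_sum M (K : R) i j : pos_mx M -> row_stochastic M ->
  (forall i j k l, cross_ratio M i j k l <= K) ->
  col_sum M j <= n.+1%:R * K * M i j.
Proof.
move=> Mp Mr MK.
have le_col k : M k j <= K * M i j.
  rewrite -[M k j]mulr1 -(Mr i) -[leRHS]mulr1 -(Mr k) !mulr_sumr.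
  apply: ler_sum => l _; rewrite -mulrA mulrC -ler_pdivrMr ?mulr_gt0 //.
  exact: MK.
rewrite /col_sum (le_trans (ler_sum _ (fun k _ => le_col k))) //.
by rewrite sumr_const card_ord -mulrA mulr_natl.
Qed.

(** The column sums of a row-stochastic matrix average to 1, so a small spread
    puts each of them near 1. *)
Lemma col_sum_le M (e : R) j : row_stochastic M -> col_spread_le e M ->
  col_sum M j <= 1 + e /\ 1 <= (1 + e) * col_sum M j.
Proof.
move=> Mr Me.
have total : \sum_i col_sum M i = n.+1%:R.
  rewrite /col_sum exchange_big /=; under eq_bigr => i _ do rewrite Mr.
  by rewrite sumr_const card_ord.
have n_gt0 : 0 < n.+1%:R :> R by rewrite ltr0n.
split; rewrite -(ler_pM2l n_gt0).
- rewrite -{2}total mulr_suml.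
  have -> : n.+1%:R * col_sum M j = \sum_(i < n.+1) col_sum M j.
    by rewrite sumr_const card_ord mulr_natl.
  by apply: ler_sum => i _; rewrite mulrC; apply: Me.
- rewrite mulr1 -{1}total.
  have -> : n.+1%:R * ((1 + e) * col_sum M j) =
            \sum_(i < n.+1) (1 + e) * col_sum M j.
    by rewrite sumr_const card_ord mulr_natl.
  by apply: ler_sum => i _; apply: Me.
Qed.

(** The contraction behind the convergence.  The new sums are averages of the
    [w j], which lie between the least one [w j0] and [(1 + e) * w j0]; each
    average gives weight at least [d] to [w j0] itself, which takes [d * e] off
    the upper end. *)
Lemma col_spread_contract M (d e : R) : pos_mx M -> row_stochastic M ->
  0 <= e -> (forall i j, d <= M i j) -> col_spread_le e M ->
  col_spread_le ((1 - d) * e) (row_scale M^T).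
Proof.
move=> Mp Mr e0 Md Me.
pose w j := (col_sum M j)^-1.
have c0 j : 0 < col_sum M j by apply: sum_ord_gt0.
have sumE i : col_sum (row_scale M^T) i = \sum_j M i j * w j.
  apply: eq_bigr => j _; rewrite !mxE; congr (_ / _).
  by apply: eq_bigr => k _; rewrite mxE.
have [j0 _ w_min] := @arg_minP _ _ 'I_n.+1 ord0 xpredT w isT.
have w_max j : w j <= (1 + e) * w j0.
  by rewrite /w ler_pdivlMr // mulrC ler_pdivrMr.
have w0 : 0 < w j0 by rewrite invr_gt0.
have lower i : w j0 <= col_sum (row_scale M^T) i.
  rewrite sumE -[leLHS]mul1r -(Mr i) mulr_suml; apply: ler_sum => j _.
  by rewrite ler_wpM2l ?w_min // ltW.
have upper i : col_sum (row_scale M^T) i <= (1 + (1 - d) * e) * w j0.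
  have rest : \sum_(j | j != j0) M i j = 1 - M i j0.
    by have := Mr i; rewrite (bigD1 j0) //= => <-; rewrite addrAC subrr add0r.
  rewrite sumE (bigD1 j0) //=.
  have : \sum_(j | j != j0) M i j * w j <= (1 - M i j0) * ((1 + e) * w j0).
    rewrite -rest mulr_suml; apply: ler_sum => j _.
    by rewrite ler_wpM2l ?w_max // ltW.
  have : 0 <= e * w j0 * (M i j0 - d).
    by rewrite mulr_ge0 ?subr_ge0 // mulr_ge0 // ltW.
  lra.
move=> i i'; apply: le_trans (upper i) _.
rewrite ler_wpM2l //.
have d1 : d <= 1.
  apply: le_trans (Md i i) _; rewrite -(Mr i) (bigD1 i) //= lerDl.
  by rewrite sumr_ge0 // => j _; apply: ltW.
by rewrite addr_ge0 // mulr_ge0 // subr_ge0.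
Qed.
End Scaling.

(** * Convergence criteria *)

Lemma cvg_mx_entry (R : realType) (m n : nat) (u : nat -> 'M[R]_(m.+1, n.+1))
    (L : 'M[R]_(m.+1, n.+1)) :
  (forall i j, (fun k => u k i j) @ \oo --> L i j) -> u @ \oo --> L.
Proof.
move=> uL; apply/cvg_mx_entourageP => A entA.
apply: filter_forall => i; apply: filter_forall => j.
have /cvg_entourageP/(_ A entA) near_ij := uL i j.
near do rewrite inE.
exact: near_ij.
Unshelve. all: by end_near.
Qed.

Lemma cvg_geometric_increment (R : realType) (u : R^nat) (a q : R) :
  0 <= q < 1 -> (forall k, `|u k.+1 - u k| <= a * q ^+ k) -> cvgn u.
Proof.
move=> /andP[q0 q1] uq.
have a0 : 0 <= a.
  by have := le_trans (normr_ge0 _) (uq 0%N); rewrite expr0 mulr1.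
have tel : cvgn (series (telescope u)).
  apply: normed_cvg; apply: (@series_le_cvg _ _ (geometric a q)) => //.
  - by move=> k; apply: normr_ge0.
  - by move=> k; rewrite /= mulr_ge0 // exprn_ge0.
  - by apply: is_cvg_geometric_series; rewrite ger0_norm.
have -> : u = (fun k => u 0%N + series (telescope u) k).
  by apply/funext => k; rewrite -eq_sum_telescope.
by apply: is_cvgD => //; apply: is_cvg_cst.
Qed.

(** Used for the row and column sums of the iterates, to show that those of the
    limit are 1. *)
Lemma cvg_geometric_err_eq1 (R : realType) (u : R^nat) (l a q : R) :
  0 <= q < 1 ->
  u @ \oo --> l -> (forall k, `|u k - 1| <= a * q ^+ k) -> l = 1.
Proof.
move=> /andP[q0 q1] ul uq; apply: (cvg_unique _ ul) => //.
apply/cvgrPdist_le => eps eps0; near=> k; rewrite distrC.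
apply: (le_trans (uq k)); apply: (le_trans (ler_norm _)).
rewrite -[X in `|X|]subr0 distrC; near: k.
apply: cvgr_dist_le => //; apply: (@cvg_geometric _ a q).
by rewrite ger0_norm.
Unshelve. all: by end_near. Qed.

Lemma near_one (R : realType) (c e : R) :
  0 <= e -> 0 < c -> c <= 1 + e -> 1 <= (1 + e) * c ->
  `|c - 1| <= e /\ `|c^-1 - 1| <= e.
Proof.
move=> e0; have half (t : R) :
    0 < t -> t <= 1 + e -> 1 <= (1 + e) * t -> `|t - 1| <= e.
  move=> t0 t1 t2; rewrite ler_norml; apply/andP; split; last by lra.
  have [|h] := leP 1 t; first by lra.
  have : e * t <= e by rewrite ler_piMr // ltW.
  by lra.
move=> c0 c1 c2; split; first exact: half.
apply: half; first by rewrite invr_gt0.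
- by rewrite -[c^-1]mul1r ler_pdivrMr.
- by rewrite ler_pdivlMr // mul1r.
Qed.

Lemma finite_upper_bound (R : realType) (T : finType) (f : T -> R) :
  exists2 K, 0 < K & forall t, f t <= K.
Proof.
exists (1 + \sum_t `|f t|).
  by rewrite ltr_pwDl // sumr_ge0.
move=> t; rewrite (bigD1 t) //=; apply: (le_trans (ler_norm _)).
by rewrite addrCA lerDl addr_ge0 // sumr_ge0.
Qed.

(** * Convergence of the Sinkhorn sequence *)

Section Convergence.
Context {R : realType} {n : nat} (A : 'M[R]_n.+1) (A_gt0 : pos_mx A).

(** Transposing before each normalization turns column scaling into row scaling,
    so that the alternating sequence becomes the iteration of a single map with
    row-stochastic values. *)
Definition half_step (k : nat) : 'M[R]_n.+1 :=
  iter k (fun M => row_scale M^T) (row_scale A).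

Lemma sinkhorn_seq_half_step k :
  sinkhorn_seq A k.+1 = if odd k then (half_step k)^T else half_step k.
Proof.
elim: k => [//|k IH]; rewrite [LHS]/= -/(sinkhorn_seq A k.+1) IH /=.
by case: (odd k); rewrite //= col_scaleE.
Qed.

Lemma half_step_gt0 k : pos_mx (half_step k).
Proof.
by elim: k => [|k IH] /=; apply: pos_row_scale => //; apply: pos_mx_tr.
Qed.

Lemma half_step_stochastic k : row_stochastic (half_step k).
Proof.
case: k => [|k] /=; apply: row_scale_stochastic => //.
by apply: pos_mx_tr; apply: half_step_gt0.
Qed.

Lemma cross_ratio_half_step k i j l m :
  cross_ratio (half_step k) i j l m =
  if odd k then cross_ratio A j i m l else cross_ratio A i j l m.
Proof.
elim: k i j l m => [|k IH] i j l m /=; first exact: cross_ratio_row_scale.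
rewrite cross_ratio_row_scale ?cross_ratio_tr ?IH; last first.
  by apply: pos_mx_tr; apply: half_step_gt0.
by case: (odd k).
Qed.

Lemma cross_ratio_sinkhorn k i j l m :
  cross_ratio (sinkhorn_seq A k) i j l m = cross_ratio A i j l m.
Proof.
case: k => // k; rewrite sinkhorn_seq_half_step.
case: (boolP (odd k)) => ok.
  by rewrite cross_ratio_tr cross_ratio_half_step ok.
by rewrite cross_ratio_half_step (negbTE ok).
Qed.

(** The lower bound [d] on the entries and the contraction by [1 - d] depend on
    each other: [d] is computed from the initial spread [e] and the largest
    cross-ratio of [A], and an iterate satisfies the bound because its spread has
    not grown beyond [e]. *)
Lemma half_step_bounds : exists d e : R,
  [/\ 0 < d <= 1, 0 <= e,
      forall k i j, d <= half_step k i j &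
      forall k, col_spread_le ((1 - d) ^+ k * e) (half_step k)].
Proof.
have c_gt0 k j : 0 < col_sum (half_step k) j.
  by apply: sum_ord_gt0 => i; apply: half_step_gt0.
have [K K0 crossK] := finite_upper_bound R _
  (fun t : 'I_n.+1 * 'I_n.+1 * 'I_n.+1 * 'I_n.+1 =>
     cross_ratio A t.1.1.1 t.1.1.2 t.1.2 t.2).
have [e e0 spread0] := finite_upper_bound R _
  (fun t : 'I_n.+1 * 'I_n.+1 =>
     col_sum (half_step 0) t.1 / col_sum (half_step 0) t.2).
have D0 : 0 < (1 + e) * (n.+1%:R * K) by rewrite !mulr_gt0 ?ltr0n // addr_gt0.
(* By [col_sum_le] the column sums are at least [(1 + e)^-1]; the other factor
   comes from [entry_ge_col_sum]. *)
pose d := ((1 + e) * (n.+1%:R * K))^-1.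
have d0 : 0 < d by rewrite invr_gt0.
have lower k i j : col_spread_le e (half_step k) -> d <= half_step k i j.
  move=> sp; have [_ c_ge] := col_sum_le _ _ j (half_step_stochastic k) sp.
  rewrite -[d]mul1r ler_pdivrMr // mulrC (le_trans c_ge) // -mulrA.
  rewrite ler_pM2l; last exact: addr_gt0.
  apply: entry_ge_col_sum; [exact: half_step_gt0|exact: half_step_stochastic|].
  move=> i' j' k' l'; rewrite cross_ratio_half_step.
  case: ifP => _; first exact: (crossK (j', i', l', k')).
  exact: (crossK (i', j', k', l')).
have spread_start : col_spread_le e (half_step 0).
  move=> i j; rewrite -ler_pdivrMr //; apply: (le_trans (spread0 (i, j))).
  by rewrite lerDr.
have d1 : d <= 1.
  apply: (le_trans (lower 0%N ord0 ord0 spread_start)).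
  rewrite -(half_step_stochastic 0 ord0) (bigD1 ord0) //= lerDl.
  rewrite sumr_ge0 // => j _.
  exact/ltW/(half_step_gt0 0).
have decay k : col_spread_le ((1 - d) ^+ k * e) (half_step k) ->
    col_spread_le e (half_step k).
  move=> spM i j; apply: (le_trans (spM i j)); rewrite ler_pM2r //.
  rewrite lerD2l ler_piMl ?(ltW e0) // exprn_ile1 ?subr_ge0 //.
  by rewrite gerBl ltW.
have spread k : col_spread_le ((1 - d) ^+ k * e) (half_step k).
  elim: k => [|k IH]; first by rewrite expr0 mul1r.
  have ek0 : 0 <= (1 - d) ^+ k * e.
    by rewrite mulr_ge0 ?exprn_ge0 ?subr_ge0 // ltW.
  rewrite exprS -mulrA; apply: col_spread_contract => //.
  + exact: half_step_gt0.
  + exact: half_step_stochastic.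
  + by move=> i j; apply: lower; apply: decay IH.
exists d, e; split=> //; [by rewrite d0|exact: ltW|].
by move=> k i j; apply: lower; apply: decay (spread k).
Qed.

(** Each iterate is a [half_step] or its transpose, so one of its two families of
    sums is exactly 1 and the other is controlled by the column spread. *)
Lemma sinkhorn_bounds : exists d e : R,
  [/\ 0 < d <= 1,
      forall k i j, d <= sinkhorn_seq A k.+1 i j,
      forall k i, `|\sum_j sinkhorn_seq A k.+1 i j - 1| <= e * (1 - d) ^+ k,
      forall k j, `|\sum_i sinkhorn_seq A k.+1 i j - 1| <= e * (1 - d) ^+ k &
      forall k i j, `|sinkhorn_seq A k.+2 i j - sinkhorn_seq A k.+1 i j|
                    <= e * (1 - d) ^+ k].
Proof.
have [d [e [/andP[d0 d1] e0 lower spread]]] := half_step_bounds.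
exists d, e.
have err0 k : 0 <= e * (1 - d) ^+ k.
  by rewrite mulr_ge0 // exprn_ge0 // subr_ge0.
have near1 k j : `|col_sum (half_step k) j - 1| <= e * (1 - d) ^+ k /\
                 `|(col_sum (half_step k) j)^-1 - 1| <= e * (1 - d) ^+ k.
  have [c1 c2] := col_sum_le _ _ j (half_step_stochastic k) (spread k).
  rewrite mulrC in c1 c2; apply: near_one => //.
  by apply: sum_ord_gt0 => i; apply: half_step_gt0.
have row1 k i : `|\sum_j half_step k i j - 1| <= e * (1 - d) ^+ k.
  by rewrite half_step_stochastic // subrr normr0.
(* One step divides an entry, at most 1, by a column sum close to 1. *)
have step k i j :
    `|half_step k.+1 i j - half_step k j i| <= e * (1 - d) ^+ k.
  rewrite !mxE.
  have -> : \sum_k0 (half_step k)^T i k0 = col_sum (half_step k) i.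
    by apply: eq_bigr => l _; rewrite mxE.
  rewrite -[X in _ - X]mulr1 -mulrBr normrM gtr0_norm;
    last exact: half_step_gt0.
  apply: le_trans (near1 k i).2; rewrite ler_piMl //.
  rewrite -(half_step_stochastic k j) (bigD1 i) //= lerDl.
  rewrite sumr_ge0 // => l _.
  exact/ltW/half_step_gt0.
split=> //; first by rewrite d0.
- by move=> k i j; rewrite sinkhorn_seq_half_step; case: ifP => _; rewrite ?mxE.
- move=> k i; rewrite sinkhorn_seq_half_step; case: ifP => _ //.
  under eq_bigr => j _ do rewrite mxE.
  exact: (near1 k i).1.
- move=> k j; rewrite sinkhorn_seq_half_step; case: ifP => _;
    last exact: (near1 k j).1.
  by under eq_bigr => i _ do rewrite mxE.
- move=> k i j; rewrite !sinkhorn_seq_half_step [odd k.+1]/=.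
  by case: (odd k); rewrite [~~ _]/= [(half_step _)^T _ _]mxE.
Qed.

Lemma sinkhorn_cvg : exists S : 'M[R]_n.+1,
  [/\ sinkhorn_seq A @ \oo --> S, doubly_stochastic S, pos_mx S &
      forall i j k l, cross_ratio S i j k l = cross_ratio A i j k l].
Proof.
have [d [e [/andP[d0 d1] lower rows cols steps]]] := sinkhorn_bounds.
have q01 : 0 <= 1 - d < 1 by rewrite subr_ge0 d1 gtrBl.
pose S : 'M[R]_n.+1 := \matrix_(i, j) limn (fun k => sinkhorn_seq A k.+1 i j).
have entry i j : (fun k => sinkhorn_seq A k.+1 i j) @ \oo --> S i j.
  rewrite mxE; apply: (cvg_geometric_increment _ _ _ _ q01) => k.
  exact: steps.
have S_ge i j : d <= S i j.
  rewrite mxE; apply: limr_ge.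
    by apply/cvg_ex; exists (S i j); exact: entry.
  by apply: nearW => k; apply: lower.
have S_gt0 : pos_mx S by move=> i j; apply: lt_le_trans (S_ge i j).
have sum_cvg (f : nat -> 'I_n.+1 -> R) (g : 'I_n.+1 -> R) :
    (forall i, (fun k => f k i) @ \oo --> g i) ->
    (fun k => \sum_i f k i) @ \oo --> \sum_i g i.
  move=> fg; apply: cvg_big => [|i _]; last exact: fg.
  exact: add_continuous.
exists S; split=> //.
- rewrite -cvg_shiftS; apply: cvg_mx_entry => i j; exact: entry.
- split=> i.
  + apply: (cvg_geometric_err_eq1 _ _ _ _ _ q01 _ (rows^~ i)).
    exact: sum_cvg.
  + apply: (cvg_geometric_err_eq1 _ _ _ _ _ q01 _ (cols^~ i)).
    by apply: sum_cvg => j; apply: entry.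
- move=> i j k l.
  have to_S : (fun m => cross_ratio (sinkhorn_seq A m.+1) i j k l) @ \oo -->
              cross_ratio S i j k l.
    apply: cvgM; first by apply: cvgM; apply: entry.
    by apply: cvgV; [rewrite gt_eqF // mulr_gt0|apply: cvgM; apply: entry].
  have eqA : (fun m => cross_ratio (sinkhorn_seq A m.+1) i j k l) =
             cst (cross_ratio A i j k l).
    by apply/funext => m; exact: cross_ratio_sinkhorn.
  by rewrite eqA in to_S; apply: (cvg_unique _ to_S) => //; apply: cvg_cst.
Qed.

End Convergence.

(** * Scalings of positive matrices *)

Section Symmetric.
Context {R : realType} {n : nat}.
Implicit Types A S : 'M[R]_n.+1.

(** A maximum principle.  If [e j0] is the largest [e j], each [d i * e j0] is
    at least 1 because row [i] of [S] averages the [d i * e j] to 1; column [j0]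
    of [S] averages the [d i * e j0] to exactly 1, so all of them equal 1. *)
Lemma doubly_stochastic_scaling_trivial S (d e : 'I_n.+1 -> R) :
  pos_mx S -> doubly_stochastic S ->
  (forall i, 0 < d i) -> (forall j, 0 < e j) ->
  doubly_stochastic (\matrix_(i, j) (d i * S i j * e j)) ->
  exists2 t, 0 < t & (forall i, d i = t^-1) /\ (forall j, e j = t).
Proof.
move=> S0 [S_row S_col] d0 e0 [T_row T_col].
have row1 i : d i * \sum_j S i j * e j = 1.
  by rewrite -(T_row i) mulr_sumr; apply: eq_bigr => j _; rewrite mxE mulrA.
have col1 j : \sum_i d i * S i j * e j = 1.
  by rewrite -(T_col j); apply: eq_bigr => i _; rewrite mxE.
have [j0 _ e_max] := @arg_maxP _ _ 'I_n.+1 ord0 xpredT e isT.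
have dM_ge1 i : 1 <= d i * e j0.
  rewrite -(row1 i) ler_pM2l // -[leRHS]mul1r -(S_row i) mulr_suml.
  by apply: ler_sum => j _; rewrite ler_pM2l //; exact: e_max.
have term_ge0 i : xpredT i -> 0 <= (d i * e j0 - 1) * S i j0.
  by move=> _; rewrite mulr_ge0 ?subr_ge0 // ltW.
have sum0 : \sum_i (d i * e j0 - 1) * S i j0 = 0.
  under eq_bigr => i _ do rewrite mulrBl mul1r mulrAC.
  by rewrite sumrB col1 S_col subrr.
have dM i : d i * e j0 = 1.
  have /eqP : (d i * e j0 - 1) * S i j0 = 0.
    exact: (psumr_eq0P term_ge0 sum0).
  by rewrite mulf_eq0 (gt_eqF (S0 _ _)) orbF subr_eq0 => /eqP.
have dE i : d i = (e j0)^-1.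
  by rewrite -[LHS](mulfK (lt0r_neq0 (e0 j0))) dM mul1r.
exists (e j0) => //; split=> // j.
have := col1 j; under eq_bigr => i _ do rewrite dE.
rewrite -mulr_suml -mulr_sumr S_col mulr1 => h.
by rewrite -[LHS](mulVKf (lt0r_neq0 (e0 j0))) h mulr1.
Qed.

(** Fixing two of the four indices at [ord0] in the equality of cross-ratios
    factors [S i j / A i j] into a function of [i] times a function of [j]. *)
Lemma scaling_of_cross_ratio A S : pos_mx A -> pos_mx S ->
  (forall i j k l, cross_ratio S i j k l = cross_ratio A i j k l) ->
  exists d e : 'I_n.+1 -> R,
    [/\ forall i, 0 < d i, forall j, 0 < e j &
        forall i j, S i j = d i * A i j * e j].
Proof.
move=> A0 S0 crossE.
exists (fun i => S i ord0 / A i ord0).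
exists (fun j => S ord0 j * A ord0 ord0 / (A ord0 j * S ord0 ord0)).
split=> [i|j|i j]; try by rewrite !(divr_gt0, mulr_gt0).
have : cross_ratio S i j ord0 ord0 *
       (S i ord0 * S ord0 j / S ord0 ord0) = S i j.
  by rewrite /cross_ratio; field; rewrite !gt_eqF.
rewrite crossE => <-; rewrite /cross_ratio.
by field; rewrite !gt_eqF.
Qed.

(** [S^T] is the scaling of [S] by [e i / d i] on rows and [d j / e j] on
    columns, and it is doubly stochastic, hence [e i / d i] is a constant
    [t^-1]: this gives [S^T = S], and [d i / sqrt t] can be used on both
    sides. *)
Lemma symmetric_scaling A S : pos_mx A -> A^T = A -> pos_mx S ->
  doubly_stochastic S ->
  (forall i j k l, cross_ratio S i j k l = cross_ratio A i j k l) ->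
  S^T = S /\ exists2 x : 'I_n.+1 -> R, forall i, 0 < x i &
             forall i j, S i j = x i * A i j * x j.
Proof.
move=> A0 Asym S0 S_ds /(scaling_of_cross_ratio _ _ A0 S0) [d [e [d0 e0 SE]]].
have AE i j : A j i = A i j by rewrite -[in RHS]Asym mxE.
have trE : S^T = \matrix_(i, j) (e i / d i * S i j * (d j / e j)).
  apply/matrixP => i j; rewrite !mxE !SE AE.
  by field; rewrite !gt_eqF.
have tr_ds : doubly_stochastic S^T.
  by case: S_ds => r c; split=> i; [rewrite -(c i)|rewrite -(r i)];
    apply: eq_bigr => j _; rewrite mxE.
rewrite trE in tr_ds.
have [||t t0 [edE deE]] :=
  doubly_stochastic_scaling_trivial _ _ _ S0 S_ds _ _ tr_ds.
- by move=> i; rewrite divr_gt0.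
- by move=> j; rewrite divr_gt0.
split.
  rewrite trE; apply/matrixP => i j; rewrite mxE edE deE.
  by field; rewrite gt_eqF.
exists (fun i => d i / Num.sqrt t) => [i|i j].
  by rewrite divr_gt0 // sqrtr_gt0.
have eE : e j = d j / t.
  by rewrite -(deE j) invf_div mulrC mulfVK // gt_eqF.
rewrite SE eE -{1}(sqr_sqrtr (ltW t0)).
by field; rewrite gt_eqF // sqrtr_gt0.
Qed.

(** The diagonal entry [A i i * X i i ^+ 2] of [X A X] determines [X i i]. *)
Lemma pos_diag_scaling_unique A (X Y : 'M[R]_n.+1) : pos_mx A ->
  pos_diag_mx X -> pos_diag_mx Y -> X *m A *m X = Y *m A *m Y -> X = Y.
Proof.
move=> A0 [/is_diag_mxP Xd X0] [/is_diag_mxP Yd Y0] XY.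
have diagE (Z : 'M[R]_n.+1) :
    (forall i j : 'I_n.+1, i != j :> nat -> Z i j = 0) ->
    forall i, (Z *m A *m Z) i i = A i i * Z i i ^+ 2.
  move=> Zd i; rewrite mxE (bigD1 i) //= big1 => [|j ji]; last first.
    by rewrite Zd ?mulr0.
  rewrite mxE (bigD1 i) //= big1 => [|j ji]; last first.
    by rewrite Zd ?mul0r // eq_sym.
  by rewrite !addr0; ring.
apply/matrixP => i j; have [->|ij] := eqVneq i j; last by rewrite Xd ?Yd.
have := congr1 (fun Z : 'M[R]_n.+1 => Z j j) XY; rewrite /= !diagE //.
move=> /(mulfI (lt0r_neq0 (A0 j j))) /eqP.
by rewrite eqrXn2 // ?ltW // => /eqP.
Qed.

End Symmetric.

(** * The quartic equation *)

(** The expression on the left is the resultant of two quadratics. *)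
Lemma resultant22_eq0 (K : comRingType) (f2 f1 f0 g2 g1 g0 p : K) :
  f2 * p ^+ 2 + f1 * p + f0 = 0 -> g2 * p ^+ 2 + g1 * p + g0 = 0 ->
  (f2 * g0 - f0 * g2) ^+ 2 - (f2 * g1 - f1 * g2) * (f1 * g0 - f0 * g1) = 0.
Proof.
move=> hf hg.
have -> : f0 = - (f2 * p ^+ 2 + f1 * p).
  by apply/eqP; rewrite -addr_eq0 addrC hf.
have -> : g0 = - (g2 * p ^+ 2 + g1 * p).
  by apply/eqP; rewrite -addr_eq0 addrC hg.
ring.
Qed.

(** With [x], [y], [w] the diagonal of [X], the hypotheses say that the rows of
    [X A X] sum to 1. *)
Lemma quartic_root (R : realType) (a11 a12 a13 a22 a23 a33 x y w : R) :
  a13 != 0 ->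
  x * (a11 * x + a12 * y + a13 * w) = 1 ->
  y * (a12 * x + a22 * y + a23 * w) = 1 ->
  w * (a13 * x + a23 * y + a33 * w) = 1 ->
  quartic_c4 a11 a12 a13 a22 a23 a33 * (x ^+ 2) ^+ 4
  + quartic_c3 a11 a12 a13 a22 a23 a33 * (x ^+ 2) ^+ 3
  + quartic_c2 a11 a12 a13 a22 a23 a33 * (x ^+ 2) ^+ 2
  + quartic_c1 a11 a12 a13 a22 a23 a33 * x ^+ 2
  + quartic_c0 a11 a12 a13 a22 a23 a33 = 0.
Proof.
move=> a13_neq0 row1 row2 row3.
pose z := x ^+ 2; pose p := x * y; pose q := x * w; pose L := 1 - a11 * z.
have hq : a13 * q = L - a12 * p by rewrite /L -row1 /q /z /p; ring.
(* Multiplied by [x ^+ 2], the other two equations involve the unknowns only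
   through [p], [q] and [z]. *)
have row2z : a12 * p * z + a22 * p ^+ 2 + a23 * p * q = z.
  by rewrite -[RHS]mulr1 -row2 /p /q /z; ring.
have row3z : a13 * q * z + a23 * p * q + a33 * q ^+ 2 = z.
  by rewrite -[RHS]mulr1 -row3 /p /q /z; ring.
have hL : L = a13 * q + a12 * p by rewrite hq subrK.
have F0 : (a13 * a22 - a12 * a23) * p ^+ 2 + (a12 * a13 * z + a23 * L) * p
          + - (a13 * z) = 0.
  transitivity (a13 * (a12 * p * z + a22 * p ^+ 2 + a23 * p * q - z)).
    by rewrite hL; ring.
  by rewrite row2z subrr mulr0.
have G0 : (a12 ^+ 2 * a33 - a12 * a13 * a23) * p ^+ 2
          + (a13 * a23 * L - a12 * a13 ^+ 2 * z - 2 * a12 * a33 * L) * p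
          + (a13 ^+ 2 * z * L + a33 * L ^+ 2 - a13 ^+ 2 * z) = 0.
  transitivity (a13 ^+ 2 * (a13 * q * z + a23 * p * q + a33 * q ^+ 2 - z)).
    by rewrite hL; ring.
  by rewrite row3z subrr mulr0.
have res0 := resultant22_eq0 _ _ _ _ _ _ _ _ F0 G0.
(* The resultant is [a13 ^+ 2] times the quartic. *)
apply: (mulfI (expf_neq0 2 a13_neq0)); rewrite mulr0 -res0 -/z.
rewrite /L /quartic_c4 /quartic_c3 /quartic_c2 /quartic_c1 /quartic_c0.
ring.
Qed.

Theorem theorem1 (R : realType) (a11 a12 a13 a22 a23 a33 : R)
    (ha11 : 0 < a11) (ha12 : 0 < a12) (ha13 : 0 < a13)
    (ha22 : 0 < a22) (ha23 : 0 < a23) (ha33 : 0 < a33) :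
  let A := sym3 a11 a12 a13 a22 a23 a33 in
  let S := sinkhorn_limit A in
  let c4 := quartic_c4 a11 a12 a13 a22 a23 a33 in
  let c3 := quartic_c3 a11 a12 a13 a22 a23 a33 in
  let c2 := quartic_c2 a11 a12 a13 a22 a23 a33 in
  let c1 := quartic_c1 a11 a12 a13 a22 a23 a33 in
  let c0 := quartic_c0 a11 a12 a13 a22 a23 a33 in
  [/\ cvg (sinkhorn_seq A @ \oo),
      S^T = S,
      doubly_stochastic S &
      exists z : R,
        [/\ 0 < z,
            c4 * z ^+ 4 + c3 * z ^+ 3 + c2 * z ^+ 2 + c1 * z + c0 = 0,
            S 0 0 = a11 * z &
            exists X : 'M[R]_3,
              unique (fun Y : 'M[R]_3 =>
                        pos_diag_mx Y /\ S = Y *m A *m Y) X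
              /\ X 0 0 = Num.sqrt z]].
Proof.
move=> A S c4 c3 c2 c1 c0.
have A0 : pos_mx A.
  by move=> [[|[|[]]]] // ? [[|[|[]]]] // ?; rewrite mxE.
have Asym : A^T = A.
  by apply/matrixP => -[[|[|[]]]] // ? [[|[|[]]]] // ?; rewrite !mxE.
have [S' [cvgS S_ds S0 cross]] := sinkhorn_cvg A A0.
have SE : S = S' by apply: norm_cvg_lim.
rewrite -{}SE in cvgS S_ds S0 cross.
have [S_sym [x x0 xAx]] := symmetric_scaling _ _ A0 Asym S0 S_ds cross.
split=> //.
exists (x 0 ^+ 2).
pose X : 'M[R]_3 := diag_mx (\row_i x i).
have XE : S = X *m A *m X.
  apply/matrixP => i j; rewrite mul_mx_diag mxE mul_diag_mx !mxE xAx.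
  by rewrite /A /sym3 mxE.
have X_diag : pos_diag_mx X.
  by split; [exact: diag_mx_is_diag|move=> i; rewrite !mxE eqxx mulr1n].
split.
- by rewrite exprn_gt0.
- have rowE i : x i * \sum_j A i j * x j = 1.
    by rewrite -(S_ds.1 i) mulr_sumr; apply: eq_bigr => j _; rewrite xAx mulrA.
  have := (rowE 0, rowE (lift ord0 ord0), rowE (lift ord0 (lift ord0 ord0))).
  rewrite !big_ord_recl !big_ord0 !mxE /= !addr0.
  case; case; move=> r1 r2 r3.
  apply: (quartic_root _ _ _ _ _ _ _ _ (x (lift ord0 ord0))
                       (x (lift ord0 (lift ord0 ord0)))).
  + by rewrite gt_eqF.
  + by rewrite -addrA.
  + by rewrite -addrA; exact: r2.
  + by rewrite -addrA; exact: r3.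
- by rewrite xAx mxE /=; ring.
- exists X; split.
    split=> // Y [Y_diag YE]; apply: (pos_diag_scaling_unique _ _ _ A0) => //.
    by rewrite -XE -YE.
  by rewrite !mxE eqxx mulr1n sqrtr_sqr gtr0_norm.
Qed.
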